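(* Let $\mathbb{K}$ be a finite field and let $A$ and $A'$ be two algebras over $\mathbb{K}$ of the same finite dimension. Let $G_1(A), G_1(A'), G_2(A), G_2(A')$ be the vertex-colored graphs defined in the context. (a) If $A$ and $A'$ are isotopic, then the vertex-colored graphs $G_1(A)$ and $G_1(A')$ are isomorphic. Conversely, if $G_1(A)$ and $G_1(A')$ are isomorphic, then there exist three bijective maps (not necessarily linear) $f,g,h:A\to A'$ such that $f(u)g(v)=h(uv)$ for all $u,v\in A$. (b) If $A$ and $A'$ are isomorphic, then the vertex-colored graphs $G_2(A)$ and $G_2(A')$ are isomorphic. Conversely, if $G_2(A)$ and $G_2(A')$ are isomorphic, then there exists a bijective map (not necessarily linear) $f:A\to A'$ such that $f(u)f(v)=f(uv)$ for all $u,v\in A$.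
   Context: An algebra over $\mathbb{K}$ is a $\mathbb{K}$-vector space with a bilinear multiplication (not assumed associative, commutative or unital). Two algebras $A,A'$ over $\mathbb{K}$ are isotopic if there are three non-singular (bijective) linear maps $f,g,h:A\to A'$ with $f(u)g(v)=h(uv)$ for all $u,v\in A$; they are isomorphic if this holds with $f=g=h$. For an algebra $A$: $\mathrm{Ann}_{A^-}(A)=\{u\in A\mid uv=0 \text{ for all } v\in A\}$, $\mathrm{Ann}_{A^+}(A)=\{u\in A\mid vu=0 \text{ for all } v\in A\}$, and $A^2=\{uv\mid u,v\in A\}$. The graph $G_1(A)$ has vertex set $R_A\cup C_A\cup S_A\cup T_A$ (disjoint union), where $R_A=\{r_u\mid u\in A\setminus \mathrm{Ann}_{A^-}(A)\}$, $C_A=\{c_u\mid u\in A\setminus \mathrm{Ann}_{A^+}(A)\}$, $S_A=\{s_u\mid u\in A^2\setminus\{0\}\}$, $T_A=\{t_{u,v}\mid u,v\in A,\ uv\neq 0\}$. These four sets are the color classes (four distinct colors: one for all $R$-sets, one for all $C$-sets, one for all $S$-sets, one for all $T$-sets). Its edges are $r_ut_{u,v}$, $c_vt_{u,v}$, $s_{uv}t_{u,v}$ for all $u,v\in A$ with $uv\neq 0$. The graph $G_2(A)$ has the same vertices and colors, and its edges are those of $G_1(A)$ together with the edges $r_uc_u$ for $u\in A\setminus(\mathrm{Ann}_{A^-}(A)\cup\mathrm{Ann}_{A^+}(A))$, $c_us_u$ for $u\in A^2\setminus \mathrm{Ann}_{A^+}(A)$, and $r_us_u$ for $u\in A^2\setminus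 \mathrm{Ann}_{A^-}(A)$. An isomorphism of vertex-colored graphs is a bijection between the vertex sets that preserves adjacency (in both directions) and preserves the color of every vertex. *)

(* Defs.v *)
From HB Require Import structures.
From mathcomp Require Import all_boot all_algebra all_field.

Set Implicit Arguments.
Unset Strict Implicit.
Unset Printing Implicit Defensive.

Import GRing.Theory.
Local Open Scope ring_scope.

Record colored_graph (C : Type) := ColoredGraph {
  vertex : finType;
  adj : rel vertex;
  color : vertex -> C;
  adj_sym : symmetric adj;
  adj_irrefl : irreflexive adj
}.
Arguments adj {C} c _ _.
Arguments color {C} c _.

Definition colored_graph_iso (C : Type) (G H : colored_graph C) : Prop :=
  exists phi : vertex G -> vertex H,
    [/\ bijective phi,
        forall x y, adj H (phi x) (phi y) = adj G x y
      & forall x, color H (phi x) = color G x].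

Inductive vcolor := Rcolor | Ccolor | Scolor | Tcolor.

(* The symbols r_u, c_u, s_u and t_{u,v}, for arbitrary u and v; the vertices
   of the graphs are the symbols selected by [is_vertex] below. *)
Inductive label (T : Type) := Rl of T | Cl of T | Sl of T | Tl of T & T.
Arguments Rl {T}.
Arguments Cl {T}.
Arguments Sl {T}.
Arguments Tl {T}.

Section LabelFinite.
Variable T : Type.

Definition label_code (x : label T) : T + T + (T + T * T) :=
  match x with
  | Rl u => inl (inl u)
  | Cl u => inl (inr u)
  | Sl u => inr (inl u)
  | Tl u v => inr (inr (u, v))
  end.

Definition label_decode (c : T + T + (T + T * T)) : label T :=
  match c with
  | inl (inl u) => Rl u
  | inl (inr u) => Cl u
  | inr (inl u) => Sl u
  | inr (inr (u, v)) => Tl u v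
  end.

Lemma label_codeK : cancel label_code label_decode.
Proof. by case. Qed.

End LabelFinite.

HB.instance Definition _ (T : finType) :=
  Finite.copy (label T) (can_type (@label_codeK T)).

Definition label_color (T : Type) (x : label T) : vcolor :=
  match x with
  | Rl _ => Rcolor
  | Cl _ => Ccolor
  | Sl _ => Scolor
  | Tl _ _ => Tcolor
  end.

Section AlgebraGraphs.
(* An algebra is a finite-dimensional space A with a bilinear product;
   [finvect_type A] is A itself, seen as a finite type. *)
Variables (K : finFieldType) (A : vectType K) (mul : {bilinear A -> A -> A}).
Local Notation fA := (finvect_type A).

Definition annl : {set fA} := [set u : fA | [forall v : fA, mul u v == 0]].
Definition annr : {set fA} := [set u : fA | [forall v : fA, mul v u == 0]].
(* The set of products, not its linear span. *)
Definition sqr_set : {set fA} := [set (mul u v : fA) | u : fA, v : fA].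

Definition is_vertex (x : label fA) : bool :=
  match x with
  | Rl u => u \notin annl
  | Cl u => u \notin annr
  | Sl u => u \in sqr_set :\ 0
  | Tl u v => mul u v != 0
  end.

Definition graph_vertex : finType := {x : label fA | is_vertex x}.

Definition arc1 (x y : label fA) : bool :=
  match x, y with
  | Rl w, Tl u v => w == u
  | Cl w, Tl u v => w == v
  | Sl w, Tl u v => w == mul u v
  | _, _ => false
  end.

Definition arc2 (x y : label fA) : bool :=
  arc1 x y ||
  match x, y with
  | Rl u, Cl v => (u == v) && (u \notin annl :|: annr)
  | Cl u, Sl v => (u == v) && (u \in sqr_set :\: annr)
  | Rl u, Sl v => (u == v) && (u \in sqr_set :\: annl)
  | _, _ => false
  end.

Definition edge1 : rel graph_vertex :=
  fun x y => arc1 (val x) (val y) || arc1 (val y) (val x).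
Definition edge2 : rel graph_vertex :=
  fun x y => arc2 (val x) (val y) || arc2 (val y) (val x).
Definition graph_color (x : graph_vertex) : vcolor := label_color (val x).

Lemma edge1_sym : symmetric edge1.
Proof. by move=> x y; rewrite /edge1 orbC. Qed.
Lemma edge1_irrefl : irreflexive edge1.
Proof. by rewrite /edge1 => x; case: (val x). Qed.
Lemma edge2_sym : symmetric edge2.
Proof. by move=> x y; rewrite /edge2 orbC. Qed.
Lemma edge2_irrefl : irreflexive edge2.
Proof. by rewrite /edge2 /arc2 => x; case: (val x). Qed.

Definition G1 : colored_graph vcolor :=
  ColoredGraph graph_color edge1_sym edge1_irrefl.
Definition G2 : colored_graph vcolor :=
  ColoredGraph graph_color edge2_sym edge2_irrefl.

End AlgebraGraphs.

Definition isotopic (K : fieldType) (A A' : vectType K)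
    (mul : {bilinear A -> A -> A}) (mul' : {bilinear A' -> A' -> A'}) : Prop :=
  exists f g h : {linear A -> A'},
    [/\ bijective f, bijective g, bijective h
      & forall u v, mul' (f u) (g v) = h (mul u v)].

Definition isomorphic (K : fieldType) (A A' : vectType K)
    (mul : {bilinear A -> A -> A}) (mul' : {bilinear A' -> A' -> A'}) : Prop :=
  exists f : {linear A -> A'},
    bijective f /\ forall u v, mul' (f u) (f v) = f (mul u v).

(* Main.v *)
Require Import Defs.
From HB Require Import structures.
From mathcomp Require Import all_boot all_algebra all_field.

Set Implicit Arguments.
Unset Strict Implicit.
Unset Printing Implicit Defensive.

Import GRing.Theory.
Local Open Scope ring_scope.

(** From algebras to graphs: an isotopism (f, g, h) maps R-labels by f, C-labels
    by g, S-labels by h and t_{u,v} to t_{f u, g v}; each condition that selects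
    vertices or edges is expressed by products, hence is preserved
    ([G1_isotopism]).  The edges of G_2 that compare the labels u of vertices
    with different colors are preserved when f, g and h are one and the same map
    ([G2_isotopism]).

    From graphs to algebras: a vertex t_{u,v} has exactly one neighbour of each
    other color in G_1, namely r_u, c_v and s_{uv}.  If a graph isomorphism maps
    t_{u,v} to t_{u',v'}, it therefore maps r_u to r_u', c_v to c_v' and
    s_{uv} to s_{u'v'}.  Recording which u goes to which u' on the vertices of
    one color, and adding the pair (0, 0), gives a one-to-one correspondence
    between parts of A and A' ([trace]), which extends to a bijection because A
    and A' have the same cardinality ([one_to_one_extend]).  Three bijections
    f, g, h extending the traces on the R-, C- and S-vertices satisfy
    f(u) g(v) = h(uv): this was just seen if uv <> 0; if f(u) g(v) <> 0 then
    t_{f u, g v} is the image of some t_{a,b}, and f a = f u, g b = g v force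
    this vertex to be t_{u,v}, so uv <> 0; and if both products vanish, what
    remains is h 0 = 0 ([trace_mul]).

    In G_2, two vertices of different colors among R, C, S are adjacent exactly
    when they carry the same element ([edge2_eq_point]).  So the three traces
    agree wherever they overlap, and their union is still one-to-one; a single
    f extends all of them, and the argument for G_1 applies with f = g = h,
    since G_1 is recovered from G_2 as the edges with an end in T ([edge1E]). *)

(** * Partial bijections between finite types *)

Definition one_to_one (T T' : eqType) (r : T -> T' -> bool) : Prop :=
  forall x x' y y', r x y -> r x' y' -> (x == x') = (y == y').

(** A one-to-one relation matches its domain D with its range E, so the
    complements of D and E have the same size when T and T' have; they are
    matched by the rank of an element in the enumeration of the complement. *)
Lemma one_to_one_extend (T T' : finType) (r : T -> T' -> bool) :
  #|T| = #|T'| -> one_to_one r ->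
  exists2 f : T -> T', bijective f & forall x y, r x y -> f x = y.
Proof.
move=> eqTT' r11.
pose D := [set x | [exists y, r x y]]; pose E := [set y | [exists x, r x y]].
have DP x : reflect (exists y, r x y) (x \in D) by rewrite inE; apply: existsP.
have EP y : reflect (exists x, r x y) (y \in E) by rewrite inE; apply: existsP.
have pickE x y : r x y -> [pick y | r x y] = Some y.
  move=> rxy; case: pickP => [z rxz|/(_ y)]; last by rewrite rxy.
  by congr Some; apply/eqP; rewrite -(r11 _ _ _ _ rxz rxy).
have eqDE : #|D| = #|E|.
  (* Seen as a function to [option T'], the relation is total, and injective
     on D with image Some @: E. *)
  rewrite -(card_in_imset (f := fun x => [pick y | r x y])); last first.
    move=> x x' /DP[y rxy] /DP[y' rxy']; rewrite (pickE _ _ rxy) (pickE _ _ rxy').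
    by case=> eqy; apply/eqP; rewrite (r11 _ _ _ _ rxy rxy') eqy.
  rewrite -(card_imset (mem E) (@Some_inj _)); apply: eq_card => o; move: o.
  suff -> : [set [pick y | r x y] | x in D] = Some @: E by [].
  apply/setP=> o; apply/imsetP/imsetP => [[x /DP[y rxy] ->]|[y /EP[x rxy] ->]].
    by exists y; [apply/EP; exists x | apply: pickE].
  by exists x; [apply/DP; exists y | rewrite (pickE _ _ rxy)].
have eqCDE : size (enum (~: D)) = size (enum (~: E)).
  have := cardsC D; rewrite eqTT' -(cardsC E) eqDE => /addnI.
  by rewrite !cardE.
pose r' x y := r x y ||
  [&& x \notin D, y \notin E & index x (enum (~: D)) == index y (enum (~: E))].
have [f fP] : exists f : T -> T', forall x, r' x (f x).
  apply: (@fin_all_exists T (fun=> T') (fun x y => r' x y)) => x.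
  case: (boolP (x \in D)) => [/DP[y rxy]|xD]; first by exists y; rewrite /r' rxy.
  have ltx : (index x (enum (~: D)) < size (enum (~: E)))%N.
    by rewrite -eqCDE index_mem mem_enum inE.
  have /card_gt0P[y0 _] : (0 < #|T'|)%N by rewrite -eqTT'; apply/card_gt0P; exists x.
  exists (nth y0 (enum (~: E)) (index x (enum (~: D)))).
  rewrite /r' xD index_uniq ?enum_uniq // eqxx andbT /=.
  by have := mem_nth y0 ltx; rewrite mem_enum inE => ->; rewrite orbT.
have f_r x y : r x y -> f x = y.
  move=> rxy; have := fP x; rewrite /r'.
  have -> : x \in D by apply/DP; exists y.
  by rewrite orbF => rxf; apply/eqP; rewrite -(r11 _ _ _ _ rxf rxy).
exists f => //; apply: inj_card_bij; last by rewrite eqTT'.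
move=> x x' eqf; have := fP x'; have := fP x; rewrite /r' -eqf.
case/orP=> [rx|/and3P[xD fE /eqP ix]] /orP[rx'|/and3P[x'D fE' /eqP ix']].
- by apply/eqP; rewrite (r11 _ _ _ _ rx rx').
- by case/EP: fE'; exists x.
- by case/EP: fE; exists x'.
- have eq_ix : index x (enum (~: D)) = index x' (enum (~: D)) by rewrite ix ix'.
  have xCD : x \in enum (~: D) by rewrite mem_enum in_setC.
  have x'CD : x' \in enum (~: D) by rewrite mem_enum in_setC.
  by rewrite -(nth_index x xCD) eq_ix nth_index.
Qed.

(** * Vertices and labels *)

(** Transparent, so that equality tests between explicit colors compute. *)
Definition vcolor_comparable : comparable vcolor.
Proof. by move=> c d; rewrite /decidable; decide equality. Defined.
HB.instance Definition _ := comparableMixin vcolor_comparable.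

Definition point (T : Type) (x : label T) : option T :=
  match x with Rl u | Cl u | Sl u => Some u | Tl _ _ => None end.

Section Graph.
Variables (K : finFieldType) (A : vectType K) (mul : {bilinear A -> A -> A}).
Local Notation fA := (finvect_type A).
Implicit Types x y t : graph_vertex mul.

Lemma annlPn (u : fA) : reflect (exists v : fA, mul u v != 0) (u \notin annl mul).
Proof. by rewrite inE negb_forall; apply: existsP. Qed.

Lemma annrPn (u : fA) : reflect (exists v : fA, mul v u != 0) (u \notin annr mul).
Proof. by rewrite inE negb_forall; apply: existsP. Qed.

Lemma point_neq0 x u : point (val x) = Some u -> u != 0.
Proof.
case: x => -[v|v|v|//] /= vP [<-].
- by case/annlPn: vP => w; apply: contraNneq => ->; rewrite linear0l.
- by case/annrPn: vP => w; apply: contraNneq => ->; rewrite linear0r.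
- by move: vP; rewrite in_setD1 => /andP[].
Qed.

(** Within one of the colors R, C, S a vertex is determined by its element, and
    [edge2_eq_point] says that between two such colors equality of elements is
    adjacency: either way equality of elements is visible in the graph. *)
Lemma vertex_eq_point x y u v : graph_color x = graph_color y ->
  point (val x) = Some u -> point (val y) = Some v -> (x == y) = (u == v).
Proof.
rewrite -val_eqE /graph_color; case: (val x) (val y) => [a|a|a|a b] [c|c|c|c d] //= _;
by move=> -[<-] -[<-]; apply/eqP/eqP => [[]|->].
Qed.

(** The side conditions on the edges r_u c_u, c_u s_u and r_u s_u only say that
    both ends are vertices. *)
Lemma edge2_eq_point x y u v : graph_color x != graph_color y ->
  point (val x) = Some u -> point (val y) = Some v -> edge2 x y = (u == v).
Proof.
rewrite /graph_color /edge2 /arc2.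
case: x y => -[a|a|a|a b] xP [[c|c|c|c d] yP] //= neq [<-] [<-];
  rewrite ?eqxx // in neq; rewrite ?orbF /= -1?[c == a]eq_sym;
  case: eqP => //= eq_ac; move: xP yP; rewrite /= ?in_setU ?in_setD ?in_setD1 eq_ac.
all: by do ?case: (_ \in _).
Qed.

Lemma edge1E x y :
  edge1 x y = edge2 x y && ((graph_color x == Tcolor) || (graph_color y == Tcolor)).
Proof.
rewrite /edge1 /edge2 /arc2 /graph_color.
by case: (val x) (val y) => [a|a|a|a b] [c|c|c|c d]; rewrite /= ?orbF ?andbF ?andbT.
Qed.

(** The element carried by the neighbour with color c of a T-vertex x; 0 stands
    for the cases that do not occur. *)
Definition corner (c : vcolor) (x : label fA) : fA :=
  match c, x with
  | Rcolor, Tl u _ => u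
  | Ccolor, Tl _ v => v
  | Scolor, Tl u v => mul u v
  | _, _ => 0
  end.

Lemma edge1_corner x t : graph_color t = Tcolor -> edge1 x t ->
  point (val x) = Some (corner (graph_color x) (val t)).
Proof.
rewrite /graph_color /edge1.
by case: (val t) (val x) => [a|a|a|a b] [c|c|c|c d] //= _; rewrite orbF => /eqP->.
Qed.

Lemma exists_corner c t : c != Tcolor -> graph_color t = Tcolor ->
  exists2 x, graph_color x = c & edge1 x t.
Proof.
case: t => -[a|a|a|u v] //= uvP; rewrite /graph_color /edge1 /=.
case: c => // _ _.
- have uP : is_vertex mul (Rl u) by apply/annlPn; exists v.
  by exists (Sub (Rl u) uP) => //=; rewrite eqxx.
- have vP : is_vertex mul (Cl v) by apply/annrPn; exists u.
  by exists (Sub (Cl v) vP) => //=; rewrite eqxx.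
- have wP : is_vertex mul (Sl (mul u v)).
    by rewrite /= in_setD1 uvP; apply/imset2P; exists u v.
  by exists (Sub (Sl (mul u v : fA)) wP) => //=; rewrite eqxx.
Qed.

End Graph.

(** * Isotopisms induce graph isomorphisms *)

Definition label_map (T T' : Type) (f g h : T -> T') (x : label T) : label T' :=
  match x with
  | Rl u => Rl (f u) | Cl u => Cl (g u) | Sl u => Sl (h u)
  | Tl u v => Tl (f u) (g v)
  end.

Section Isotopism.
Variables (K : finFieldType) (A A' : vectType K).
Variables (mul : {bilinear A -> A -> A}) (mul' : {bilinear A' -> A' -> A'}).
Local Notation fA := (finvect_type A).
Local Notation fA' := (finvect_type A').
Variables f g h : fA -> fA'.
Hypotheses (bij_f : bijective f) (bij_g : bijective g) (bij_h : bijective h).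
Hypothesis h0 : h 0 = 0.
Hypothesis fgh : forall u v, mul' (f u) (g v) = h (mul u v).

Lemma mul_eq0_isotopism u v : (mul' (f u) (g v) == 0) = (mul u v == 0).
Proof. by rewrite fgh -{1}h0 (inj_eq (bij_inj bij_h)). Qed.

Lemma annl_isotopism u : (f u \in annl mul') = (u \in annl mul).
Proof.
case: bij_g => g' _ gK'; rewrite !inE; apply/forallP/forallP => uP v.
  by rewrite -mul_eq0_isotopism; apply: uP.
by rewrite -[v]gK' mul_eq0_isotopism; apply: uP.
Qed.

Lemma annr_isotopism u : (g u \in annr mul') = (u \in annr mul).
Proof.
case: bij_f => f' _ fK'; rewrite !inE; apply/forallP/forallP => uP v.
  by rewrite -mul_eq0_isotopism; apply: uP.
by rewrite -[v]fK' mul_eq0_isotopism; apply: uP.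
Qed.

Lemma sqr_isotopism u : (h u \in sqr_set mul') = (u \in sqr_set mul).
Proof.
case: bij_f bij_g => f' _ fK' [g' _ gK'].
apply/imset2P/imset2P => [[v w _ _]|[v w _ _ ->]].
  rewrite -[v]fK' -[w]gK' fgh => /(bij_inj bij_h) ->.
  by exists (f' v) (g' w).
by exists (f v) (g w); rewrite ?fgh.
Qed.

Lemma is_vertex_isotopism x : is_vertex mul' (label_map f g h x) = is_vertex mul x.
Proof.
case: x => [u|u|u|u v] /=.
- by rewrite annl_isotopism.
- by rewrite annr_isotopism.
- by rewrite !in_setD1 sqr_isotopism -{1}h0 (inj_eq (bij_inj bij_h)).
- by rewrite mul_eq0_isotopism.
Qed.

Lemma arc1_isotopism x y :
  arc1 mul' (label_map f g h x) (label_map f g h y) = arc1 mul x y.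
Proof.
case: x y => [u|u|u|u v] [w|w|w|w z] //=; last by rewrite fgh bij_eq.
all: by rewrite bij_eq.
Qed.

Lemma vertex_isotopism :
  exists2 phi : graph_vertex mul -> graph_vertex mul',
    bijective phi & forall x, val (phi x) = label_map f g h (val x).
Proof.
case: bij_f bij_g bij_h => f' fK fK' [g' gK gK'] [h' hK hK'].
have mapK : cancel (label_map f g h) (label_map f' g' h').
  by case=> [u|u|u|u v] /=; rewrite ?fK ?gK ?hK.
have mapK' : cancel (label_map f' g' h') (label_map f g h).
  by case=> [u|u|u|u v] /=; rewrite ?fK' ?gK' ?hK'.
have phiP (x : graph_vertex mul) : is_vertex mul' (label_map f g h (val x)).
  by rewrite is_vertex_isotopism; apply: valP.
have psiP (y : graph_vertex mul') : is_vertex mul (label_map f' g' h' (val y)).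
  by rewrite -is_vertex_isotopism mapK'; apply: valP.
exists (fun x => Sub (label_map f g h (val x)) (phiP x)) => //.
exists (fun y => Sub (label_map f' g' h' (val y)) (psiP y)) => x; apply: val_inj => /=.
  by rewrite mapK.
by rewrite mapK'.
Qed.

Lemma G1_isotopism : colored_graph_iso (G1 mul) (G1 mul').
Proof.
have [phi bij_phi phiE] := vertex_isotopism.
exists phi; split=> // [x y|x] /=; first by rewrite /edge1 !phiE !arc1_isotopism.
by rewrite /graph_color phiE; case: (val x).
Qed.

Lemma G2_isotopism : f =1 g -> f =1 h -> colored_graph_iso (G2 mul) (G2 mul').
Proof.
move=> fg fh; have [phi bij_phi phiE] := vertex_isotopism.
have arc2E x y : arc2 mul' (label_map f g h x) (label_map f g h y) = arc2 mul x y.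
  rewrite /arc2 arc1_isotopism; congr orb.
  case: x y => [u|u|u|u v] [w|w|w|w z] //=; rewrite -?fg -?fh (bij_eq bij_f) //.
  - by rewrite !in_setU annl_isotopism fg annr_isotopism.
  - by rewrite !in_setD annl_isotopism fh sqr_isotopism.
  - by rewrite !in_setD fg annr_isotopism -fg fh sqr_isotopism.
exists phi; split=> // [x y|x] /=; first by rewrite /edge2 !phiE !arc2E.
by rewrite /graph_color phiE; case: (val x).
Qed.

End Isotopism.

(** * Graph isomorphisms induce bijections that preserve products *)

Section Trace.
Variables (K : finFieldType) (A A' : vectType K).
Variables (mul : {bilinear A -> A -> A}) (mul' : {bilinear A' -> A' -> A'}).
Local Notation fA := (finvect_type A).
Local Notation fA' := (finvect_type A').
Variable phi : graph_vertex mul -> graph_vertex mul'.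
Hypothesis bij_phi : bijective phi.
Hypothesis color_phi : forall x, graph_color (phi x) = graph_color x.

(** How phi moves the elements carried by the R-, C- and S-vertices with color
    in P.  The element 0 is carried by no vertex; the pair (0, 0) is added so
    that any extension of a trace maps 0 to 0. *)
Definition trace (P : pred vcolor) (u : fA) (u' : fA') : bool :=
  (u == 0) && (u' == 0) ||
  [exists x, [&& P (graph_color x), point (val x) == Some u
               & point (val (phi x)) == Some u']].

(** For a single color the hypothesis is vacuous, as in the use for G_1; for
    all the colors together it is the preservation of the edges of G_2. *)
Lemma trace_one_to_one (P : pred vcolor) :
    (forall x y, P (graph_color x) -> P (graph_color y) ->
       graph_color x != graph_color y -> edge2 (phi x) (phi y) = edge2 x y) ->
  one_to_one (trace P).
Proof.
move=> edge_phi u v u' v'.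
case/orP=> [/andP[/eqP-> /eqP->]|/existsP[x /and3P[Px /eqP xu /eqP xu']]];
case/orP=> [/andP[/eqP-> /eqP->]|/existsP[y /and3P[Py /eqP yv /eqP yv']]].
- by rewrite !eqxx.
- rewrite ![0 == _]eq_sym (negPf (point_neq0 yv)).
  by rewrite (negPf (point_neq0 yv')).
- by rewrite (negPf (point_neq0 xu)) (negPf (point_neq0 xu')).
have [eq_c|neq_c] := eqVneq (graph_color x) (graph_color y).
  rewrite -(vertex_eq_point eq_c xu yv) -(bij_eq bij_phi).
  by apply: vertex_eq_point xu' yv'; rewrite !color_phi.
rewrite -(edge2_eq_point neq_c xu yv) -edge_phi //.
by apply: edge2_eq_point xu' yv'; rewrite !color_phi.
Qed.

Hypothesis edge1_phi : forall x y, edge1 (phi x) (phi y) = edge1 x y.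

Lemma trace_corner (P : pred vcolor) c t : graph_color t = Tcolor ->
  c != Tcolor -> P c -> trace P (corner mul c (val t)) (corner mul' c (val (phi t))).
Proof.
move=> tT cT Pc; have [x xc xt] := exists_corner cT tT.
apply/orP; right; apply/existsP; exists x; rewrite xc Pc /=.
rewrite (edge1_corner tT xt) xc eqxx /=.
by rewrite (@edge1_corner _ _ _ _ (phi t)) ?color_phi ?xc ?edge1_phi.
Qed.

(** The predicates PR, PC and PS cover both a separate trace for each color and
    one common trace for all of them. *)
Lemma trace_mul (PR PC PS : pred vcolor) (f g h : fA -> fA') :
    PR Rcolor -> PC Ccolor -> PS Scolor ->
    bijective f -> bijective g ->
    (forall u u', trace PR u u' -> f u = u') ->
    (forall u u', trace PC u u' -> g u = u') ->
    (forall u u', trace PS u u' -> h u = u') ->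
  forall u v, mul' (f u) (g v) = h (mul u v).
Proof.
move=> PRR PCC PSS bij_f bij_g fP gP hP u v.
have tlP t : graph_color t = Tcolor ->
    exists u v, [/\ val t = Tl u v, val (phi t) = Tl (f u) (g v)
                  & mul' (f u) (g v) = h (mul u v)].
  move=> tT; have := trace_corner tT; have := color_phi t; rewrite tT.
  move: tT; rewrite /graph_color.
  case: (val t) => // a b _; case: (val (phi t)) => // a' b' _ tr.
  exists a, b; rewrite (fP a a') ?(gP b b') ?(hP (mul a b : fA) (mul' a' b')) //.
  - exact: (tr _ Scolor).
  - exact: (tr _ Ccolor).
  - exact: (tr _ Rcolor).
have [uv0|uvN0] := eqVneq (mul u v) 0; last first.
  have [//|a [b [/= [eq_u eq_v] _]]] := tlP (Sub (Tl u v : label fA) uvN0).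
  by rewrite eq_u eq_v.
have h0 : h 0 = 0 by apply: hP; rewrite /trace !eqxx.
(* A nonzero f u * g v gives a T-vertex of the target, whose preimage under
   phi can only be t_{u,v}. *)
rewrite uv0 h0; apply/eqP/negPn/negP => fguvN0.
case: bij_phi => psi _ phiK'.
pose t := psi (Sub (Tl (f u) (g v) : label fA') fguvN0).
have [|a [b [ _ ]]] := tlP t; first by rewrite -color_phi phiK'.
rewrite phiK' => -[/(bij_inj bij_f) <- /(bij_inj bij_g) <-].
by move=> fguvE; move: (fguvN0); rewrite fguvE uv0 h0 eqxx.
Qed.

End Trace.

Lemma card_finvect (K : finFieldType) (A A' : vectType K) :
  \dim {:A} = \dim {:A'} -> #|finvect_type A| = #|finvect_type A'|.
Proof.
move=> dimAA'.
rewrite -(card_vspacef (Vector.class (finvect_type A))).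
rewrite -(card_vspacef (Vector.class (finvect_type A'))) !card_vspace.
by congr (_ ^ _)%N.
Qed.

Theorem theorem3 (K : finFieldType) (A A' : vectType K)
    (mul : {bilinear A -> A -> A}) (mul' : {bilinear A' -> A' -> A'})
    (dimAA' : \dim {:A} = \dim {:A'}) :
  ((isotopic mul mul' -> colored_graph_iso (G1 mul) (G1 mul')) /\
   (colored_graph_iso (G1 mul) (G1 mul') ->
    exists f g h : A -> A',
      [/\ bijective f, bijective g, bijective h
        & forall u v : A, mul' (f u) (g v) = h (mul u v)]))
  /\
  ((isomorphic mul mul' -> colored_graph_iso (G2 mul) (G2 mul')) /\
   (colored_graph_iso (G2 mul) (G2 mul') ->
    exists f : A -> A',
      bijective f /\ forall u v : A, mul' (f u) (f v) = f (mul u v))).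
Proof.
have card_eq := card_finvect dimAA'.
split; split.
- case=> f [g [h [bij_f bij_g bij_h fgh]]].
  exact: (G1_isotopism bij_f bij_g bij_h (linear0 h) fgh).
- case=> phi [bij_phi edge1_phi color_phi].
  have ext c : exists2 f : finvect_type A -> finvect_type A',
      bijective f & forall u u', trace phi (pred1 c) u u' -> f u = u'.
    apply: one_to_one_extend => //; apply: trace_one_to_one => // x y /=.
    by move=> /eqP-> /eqP->; rewrite eqxx.
  have [[f bij_f fP] [g bij_g gP] [h bij_h hP]] :=
    And3 (ext Rcolor) (ext Ccolor) (ext Scolor).
  exists f, g, h; split=> //.
  exact: (trace_mul bij_phi color_phi edge1_phi _ _ _ bij_f bij_g fP gP hP).
- case=> f [bij_f fM].
  exact: (G2_isotopism bij_f bij_f bij_f (linear0 f) fM).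
- case=> phi [bij_phi adj_phi col_phi].
  have edge2_phi x y : edge2 (phi x) (phi y) = edge2 x y by apply: adj_phi.
  have color_phi x : graph_color (phi x) = graph_color x by apply: col_phi.
  have [f bij_f fP] : exists2 f : finvect_type A -> finvect_type A',
      bijective f & forall u u', trace phi predT u u' -> f u = u'.
    by apply: one_to_one_extend => //; apply: trace_one_to_one.
  have edge1_phi x y : edge1 (phi x) (phi y) = edge1 x y.
    by rewrite !edge1E edge2_phi !color_phi.
  exists f; split=> //.
  exact: (trace_mul bij_phi color_phi edge1_phi _ _ _ bij_f bij_f fP fP fP).
Qed.
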